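(* There exists a (nonzero) family of linear operators $\mathcal{R}_1=\mathcal{R}_1(u_1|v_1,v_2)$ on $\mathbb{C}[z_1,z_2]$, depending only on $u_1,v_1,v_2$ (not on $u_2$) and satisfying the shift invariance $$\mathcal{R}_1(u_1|v_1,v_2)=\mathcal{R}_1(u_1+\lambda|v_1+\lambda,v_2+\lambda)\quad\text{for all }\lambda\in\mathbb{C},$$ which solves, for all generic $u_1,u_2,v_1,v_2$, the defining equations $$\mathcal{R}_{1}\,\mathrm{L}_{1}(u_1,u_2)\,\mathrm{L}_{2}(v_1,v_2)=\mathrm{L}_{1}(v_1,u_2)\,\mathrm{L}_{2}(u_1,v_2)\,\mathcal{R}_{1}.$$ These requirements fix the operator $\mathcal{R}_1$ up to an overall normalization constant (a scalar, which may depend on the parameters): up to such a factor, $$\mathcal{R}_1(u_1|v_1,v_2)\sim\frac{\Gamma(z_{21}\partial_2+u_1-v_2)}{\Gamma(z_{21}\partial_2+v_1-v_2)},\qquad z_{21}=z_2-z_1 .$$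
   Context: Notation: $\partial_k=\partial/\partial z_k$. For complex parameters $a,b$ and $k\in\{1,2\}$ the Lax operator is the $2\times2$ matrix of differential operators on $\mathbb{C}[z_1,z_2]$ $$\mathrm{L}_k(a,b)=\begin{pmatrix} a+z_k\partial_k & -\partial_k\\ z_k^2\partial_k+(a-b)z_k & b-z_k\partial_k\end{pmatrix}.$$ Products of such matrices are matrix products with operator entries, $(\mathrm{L}_1\mathrm{L}_2)_{ik}=\sum_j(\mathrm{L}_1)_{ij}(\mathrm{L}_2)_{jk}$, and an operator on $\mathbb{C}[z_1,z_2]$ placed to the left or right of a matrix multiplies (composes with) each entry from that side. Parameters are complex and generic: no pairwise difference of $u_1,u_2,v_1,v_2$ is an integer. The operator $z_{21}\partial_2$ is diagonalizable on $\mathbb{C}[z_1,z_2]$: $z_1^j z_{21}^k$ ($j,k\ge0$) is an eigenvector with eigenvalue $k$. For a function $f$ on $\{0,1,2,\dots\}$, $f(z_{21}\partial_2)$ is the operator $z_1^jz_{21}^k\mapsto f(k)z_1^jz_{21}^k$; the Gamma-function quotient is understood in this sense. *)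

(* Defs.v *)
From HB Require Import structures.
From mathcomp Require Import all_boot all_order all_algebra.
From mathcomp Require Import complex.
From mathcomp Require reals topology normedtype sequences exp trigo.
From mathcomp Require ssrcomplements mpoly.
From mathcomp Require Import ring.

Set Implicit Arguments.
Unset Strict Implicit.
Unset Printing Implicit Defensive.

Import Order.TTheory GRing.Theory Num.Theory.
Local Open Scope ring_scope.

Module ComplexGamma.
Import classical_sets reals topology normedtype sequences exp trigo.
Import numFieldTopology.Exports.
Import numFieldNormedType.Exports.
Local Open Scope classical_set_scope.

Definition cexp (R : realType) (z : R[i]) : R[i] :=
  (expR (complex.Re z))%:C%C *
    (cos (complex.Im z) +i* sin (complex.Im z))%C.

(* n ^ z = exp (z ln n), for n > 0 *)
Definition natcpow (R : realType) (n : nat) (z : R[i]) : R[i] :=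
  cexp (z * (ln (n%:R : R))%:C%C).

(* Gauss's limit n! n^z / (z (z+1) ... (z+n)), which converges to Gamma(z) for
   every z outside the poles 0, -1, -2, ...; at the poles the value is junk
   (there x / 0 = 0).  R[i]^o is R[i] with the topology of its norm. *)
Definition gauss_seq (R : realType) (z : R[i]) (n : nat) : R[i]^o :=
  n`!%:R * natcpow n z / \prod_(0 <= i < n.+1) (z + i%:R).

Definition Gamma (R : realType) (z : R[i]) : R[i] :=
  lim (gauss_seq z n @[n --> \oo]).
End ComplexGamma.

Import reals mpoly.

Section Operators.
Variable R : realType.
Local Notation C := R[i].
Local Notation P := {mpoly C[2]}.

Definition i1 : 'I_2 := ord0.
Definition i2 : 'I_2 := ord_max.

Definition z21 : P := 'X_i2 - 'X_i1.

Definition generic (s : seq C) : Prop :=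
  forall i j : nat, (i < j < size s)%N -> forall m : int, s`_i - s`_j <> m%:~R.

Definition mx22 (T : Type) (a b c d : T) : 'M[T]_2 :=
  \matrix_(i, j) if i == i1 then (if j == i1 then a else b)
                 else (if j == i1 then c else d).

Definition Lax (k : 'I_2) (a b : C) : 'M[P -> P]_2 :=
  mx22 (fun p => a *: p + 'X_k * p^`M(k))
       (fun p => - p^`M(k))
       (fun p => 'X_k ^+ 2 * p^`M(k) + (a - b) *: ('X_k * p))
       (fun p => b *: p - 'X_k * p^`M(k)).

Definition opmx_mul (A B : 'M[P -> P]_2) : 'M[P -> P]_2 :=
  \matrix_(i, k) fun p => \sum_(j < 2) A i j (B j k p).

Definition op_mull (T : P -> P) (A : 'M[P -> P]_2) : 'M[P -> P]_2 :=
  \matrix_(i, k) (T \o A i k).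
Definition op_mulr (A : 'M[P -> P]_2) (T : P -> P) : 'M[P -> P]_2 :=
  \matrix_(i, k) (A i k \o T).

Definition op_family := C -> C -> C -> {linear P -> P}.

(* A family is total, but it is only constrained, and only meaningful, at
   generic parameters. *)
Definition shift_invariant (R1 : op_family) : Prop :=
  forall u1 v1 v2 lambda : C, generic [:: u1; v1; v2] ->
    R1 u1 v1 v2 =1 R1 (u1 + lambda) (v1 + lambda) (v2 + lambda).

Definition defining_equations (R1 : op_family) : Prop :=
  forall u1 u2 v1 v2 : C, generic [:: u1; u2; v1; v2] ->
    op_mull (R1 u1 v1 v2) (opmx_mul (Lax i1 u1 u2) (Lax i2 v1 v2))
    = op_mulr (opmx_mul (Lax i1 v1 u2) (Lax i2 u1 v2)) (R1 u1 v1 v2).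

Definition nonzero_op (T : P -> P) : Prop := exists p, T p != 0.

(* [fun_z21d2 f] conjugates the diagonal operator z1^j z2^k |-> f k z1^j z2^k
   by the change of variables z2 |-> z2 - z1; [fun_z21d2_eigen] and
   [fun_z21d2_linear] show that this is f(z21 d/dz2). *)
Definition diag_op (f : nat -> C) (q : P) : P :=
  \sum_(m <- msupp q) (f (m i2) * q@_m) *: 'X_[m].

Definition fun_z21d2 (f : nat -> C) (p : P) : P :=
  diag_op f (p \mPo [tuple 'X_i1; 'X_i1 + 'X_i2]) \mPo [tuple 'X_i1; z21].

Lemma diag_op_linear f : linear (diag_op f).
Proof.
have E q : exists N, forall k, (N <= k)%N ->
    diag_op f q = \sum_(m : 'X_{1..2 < k}) (f (m i2) * q@_m) *: 'X_[m].
  exists (msize q) => k le_qk.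
  rewrite /diag_op (ssrcomplements.big_mksub 'X_{1..2 < k}) ?msupp_uniq //=; first last.
    by move=> x /msize_mdeg_lt/leq_trans/(_ le_qk).
  rewrite big_rmcond //= => m /memN_msupp_eq0 ->.
  by rewrite mulr0 scale0r.
move=> c p q.
have [a Ha] := E p; have [b Hb] := E q; have [d Hd] := E (c *: p + q).
pose k := maxn a (maxn b d).
rewrite (Ha k) ?(Hb k) ?(Hd k) ?leq_max ?leqnn ?orbT //.
rewrite scaler_sumr -big_split /=; apply: eq_bigr => m _.
by rewrite scalerA -scalerDl mcoeffD mcoeffZ mulrDr; congr ((_ + _) *: _); ring.
Qed.

Lemma diag_opX f m : diag_op f 'X_[m] = f (m i2) *: 'X_[m].
Proof. by rewrite /diag_op msuppX big_seq1 mcoeffX eqxx mulr1. Qed.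

Lemma fun_z21d2_linear f : linear (fun_z21d2 f).
Proof.
by move=> c p q; rewrite /fun_z21d2 linearP diag_op_linear linearP.
Qed.

Lemma fun_z21d2_eigen f j k :
  fun_z21d2 f ('X_i1 ^+ j * z21 ^+ k) = f k *: ('X_i1 ^+ j * z21 ^+ k).
Proof.
rewrite /fun_z21d2 rmorphM !rmorphXn rmorphB /= !comp_mpolyXU /=.
rewrite /= addrAC subrr add0r.
rewrite 2!mpolyXn -mpolyXD diag_opX linearZ /= mpolyXD -2!mpolyXn.
rewrite rmorphM !rmorphXn /= !comp_mpolyXU /=.
by congr (f _ *: _); rewrite mnmDE !mulmnE !mnm1E /= mul0n mul1n.
Qed.

Definition gamma_quotient (u1 v1 v2 : C) : P -> P :=
  fun_z21d2 (fun k => ComplexGamma.Gamma (k%:R + u1 - v2)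
                      / ComplexGamma.Gamma (k%:R + v1 - v2)).

End Operators.

(* Main.v *)
From HB Require Import structures.
Require Import Defs.
From mathcomp Require Import all_boot all_order all_algebra.
From mathcomp Require Import complex.
From mathcomp Require Import reals.
From mathcomp Require boolp classical_sets topology normedtype sequences derive.
From mathcomp Require exp trigo.
From mathcomp Require mpoly.
From mathcomp Require Import ring lra.

(** In the coordinates z1 and y = z21 = z2 - z1 write X, Y for the
    multiplications by z1 and y, Dx and Dy for the partial derivatives, and
    N = Y Dy for the Euler operator, which is z21 d/dz2.  The first row of
    L1(u1,u2) L2(v1,v2) consists of

      X (N + u1 - v2) Dy - Y (N + v1 - v2) Dx + S,
      (N - v2) Dx - (N + u1 - v2) Dy,

    where S is a polynomial in N, X, Dx with coefficients symmetric in u1 and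
    v1, and the second row is X times the first one plus u2 times

      X (N - v2) + Y (N + v1 - v2),       v2 - N

    ([Lax_mul11] to [Lax_mul22]).  Hence an operator R1 which commutes with X,
    Dx and N and satisfies

      R1 Y (N + v1 - v2) = Y (N + u1 - v2) R1,
      R1 (N + u1 - v2) Dy = (N + v1 - v2) Dy R1

    solves the defining equation ([intertwiner_defining_eq]).  An operator
    which is diagonal on the basis z1^j y^k with eigenvalue f k does so as soon
    as f (k+1) (k + v1 - v2) = f k (k + u1 - v2) ([fun_lin_intertwiner]), which
    gives existence.

    Conversely R1 depends neither on u2 nor on a common shift of u1, v1, v2.
    Comparing the equations at two values of u2 and at two shifts recovers all
    five relations ([defining_eq_intertwiner]).  They force R1 1 to be killed by
    Dx and Dy, hence constant; commutation with X and the first displayed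
    relation then determine R1 on every z1^j y^k by the above recursion
    ([intertwiner_fun_lin]).

    It remains to see that f k = Gamma(k + u1 - v2) / Gamma(k + v1 - v2) solves
    the recursion and that f 0 is nonzero, that is, Gamma (z + 1) = z Gamma z
    and Gamma z <> 0 away from the poles.  As Gamma is defined by Gauss's limit,
    its convergence has to be established: consecutive terms of the sequence,
    and of the sequence of inverses, have ratio 1 + O(1/n^2), so both converge
    like absolutely convergent products, and their limits are inverse to each
    other ([Gamma_neq0], [GammaS]). *)

Set Implicit Arguments.
Unset Strict Implicit.
Unset Printing Implicit Defensive.

Import Order.TTheory GRing.Theory Num.Theory.
Local Open Scope ring_scope.

Module GammaFacts.
Import boolp classical_sets topology normedtype sequences derive exp trigo.
Import numFieldTopology.Exports numFieldNormedType.Exports.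
Import ComplexGamma.
Local Open Scope classical_set_scope.
Local Open Scope ring_scope.

(** * Real Taylor estimates *)

Section RealEstimates.
Variable R : realType.
Implicit Types x y : R.

Lemma MVT0 (f df : R -> R) (y : R) : (forall x, is_derive x 1 f (df x)) -> 0 <= y ->
  exists2 x, 0 <= x <= y & f y - f 0 = df x * y.
Proof.
move=> fdf y0.
have dfy x : x \in `]0, y[%R -> is_derive x (1 : R) f (df x) by move=> _; exact: fdf.
have [|x + ->] := MVT_segment y0 dfy.
  apply: derivable_within_continuous => x _.
  by have /@ex_derive := fdf x.
by rewrite in_itv/= subr0; exists x.
Qed.

(** Both bounds come from applying the mean value theorem once more to the
    derivative, since sin and cos - 1 vanish at 0 and are 1-Lipschitz. *)
Lemma trig_taylor_pos y : 0 <= y ->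
  `|cos y - 1| <= y ^+ 2 /\ `|sin y - y| <= y ^+ 2.
Proof.
have sin_le (t : R) : 0 <= t -> `|sin t| <= t.
  move=> t0; have [x _] := MVT0 (f := sin) (df := cos) (y := t) _ t0.
  rewrite sin0 subr0 => ->.
  by rewrite normrM (ger0_norm t0) ler_piMl// cos_max.
have cos_mvt (t : R) : 0 <= t -> exists2 x, 0 <= x <= t & cos t - 1 = - sin x * t.
  move=> t0; have [x xt] := MVT0 (f := cos) (df := fun x => - sin x) (y := t) _ t0.
  by rewrite cos0; exists x.
have cos_le (t : R) : 0 <= t -> `|cos t - 1| <= t.
  move=> t0; have [x _ ->] := cos_mvt _ t0.
  by rewrite normrM normrN (ger0_norm t0) ler_piMl// sin_max.
move=> y0; split.
- have [x /andP[x0 xy] ->] := cos_mvt _ y0.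
  rewrite normrM normrN (ger0_norm y0) expr2 ler_wpM2r//.
  by rewrite (le_trans _ xy)// sin_le.
- have [x /andP[x0 xy]] := MVT0 (f := sin) (df := cos) (y := y) _ y0.
  rewrite sin0 subr0 => ->.
  rewrite -[X in _ - X]mul1r -mulrBl normrM (ger0_norm y0) expr2 ler_wpM2r//.
  by rewrite (le_trans _ xy)// cos_le.
Qed.

Lemma trig_taylor y : `|cos y - 1| <= y ^+ 2 /\ `|sin y - y| <= y ^+ 2.
Proof.
have [y0|/ltW y0] := leP 0 y; first exact: trig_taylor_pos.
have [|] := @trig_taylor_pos (- y); first by rewrite oppr_ge0.
by rewrite sinN cosN sqrrN -opprD normrN.
Qed.

(** The upper bounds come from expR x * (1 - x) <= 1, which is the lower bound
    1 - x <= expR (- x) read multiplicatively. *)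
Lemma expR_taylor x : `|x| <= 2^-1 ->
  `|expR x - 1| <= 2 * `|x| /\ `|expR x - 1 - x| <= 2 * x ^+ 2.
Proof.
move=> x2.
have h1 := expR_ge1Dx x; have h2 := expR_ge1Dx (- x).
have h3 := expRxMexpNx_1 x; have e0 := expR_gt0 x.
have : expR x * (1 - x) <= 1 by rewrite -[leRHS]h3 ler_pM2l //; lra.
move: x2 => /[!ler_norml] /andP[xa xb] h4.
have h5 : expR x - 1 - x <= 2 * x ^+ 2 by nra.
have h6 : 0 <= x ^+ 2 by exact: sqr_ge0.
split; last by rewrite h5 andbT; lra.
have [x0|x0] := leP 0 x; first by rewrite (ger0_norm x0); apply/andP; split; nra.
by rewrite (ltr0_norm x0); apply/andP; split; nra.
Qed.

Lemma ln_succ_sub_bounds (n : nat) : (0 < n)%N ->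
  n.+1%:R^-1 <= ln (n.+1%:R : R) - ln n%:R <= n%:R^-1.
Proof.
move=> n0; have nR : (0 : R) < n%:R by rewrite ltr0n.
have nR1 : (0 : R) < n.+1%:R by rewrite ltr0n.
apply/andP; split.
- have := @le_ln1Dx R (- n.+1%:R^-1).
  rewrite ltrN2 invf_lt1// ltr1n => /(_ n0).
  have -> : 1 + - n.+1%:R^-1 = n%:R / n.+1%:R :> R.
    by rewrite -natr1; field; rewrite natr1 gt_eqF.
  by rewrite ln_div ?posrE// => H; rewrite -[leRHS]opprB lerNr.
- have := @le_ln1Dx R (n%:R^-1).
  have -> : 1 + n%:R^-1 = n.+1%:R / n%:R :> R.
    by rewrite -natr1; field; rewrite gt_eqF.
  rewrite ln_div ?posrE//; apply.
  by rewrite (lt_trans (ltrN10 _))// invr_gt0.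
Qed.

End RealEstimates.

(** * Sequences with summable increments *)

Section RealSequence.
Variable R : realType.

Lemma telescope_inv (n : nat) : (0 < n)%N ->
  (n%:R * n.+1%:R)^-1 = n%:R^-1 - n.+1%:R^-1 :> R.
Proof.
move=> n0; have nR : (n%:R : R) != 0 by rewrite pnatr_eq0 -lt0n.
by rewrite -natr1; field; rewrite natr1 nR pnatr_eq0.
Qed.

(** Steps bounded by the telescoping terms B (1/n - 1/(n+1)) make x - B/n
    nondecreasing and x + B/n nonincreasing. *)
Lemma cvg_small_steps (x : R^nat) (B : R) N : 0 <= B -> (0 < N)%N ->
  (forall n, (N <= n)%N -> `|x n.+1 - x n| <= B * (n%:R * n.+1%:R)^-1) ->
  cvgn x.
Proof.
move=> B0 N0 xB.
pose y k := x (k + N)%N - B / (k + N)%:R.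
pose w k := x (k + N)%N + B / (k + N)%:R.
have xBk k := xB (k + N)%N (leq_addl _ _).
have pos k : (0 < k + N)%N by rewrite addn_gt0 N0 orbT.
have y_nd : nondecreasing_seq y.
  apply/nondecreasing_seqP => k; rewrite /y addSn.
  have := xBk k; rewrite telescope_inv// mulrBr.
  move: (B / (k + N)%:R) (B / (k + N).+1%:R) => p q.
  by rewrite ler_norml => /andP[? ?]; lra.
have w_ni : nonincreasing_seq w.
  apply/nonincreasing_seqP => k; rewrite /w addSn.
  have := xBk k; rewrite telescope_inv// mulrBr.
  move: (B / (k + N)%:R) (B / (k + N).+1%:R) => p q.
  by rewrite ler_norml => /andP[? ?]; lra.
have y_cvg : cvgn y.
  apply: nondecreasing_is_cvgn => //; exists (w 0%N) => _ [k _ <-].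
  rewrite (le_trans _ (w_ni _ _ (leq0n k)))// /y /w.
  have : 0 <= B / (k + N)%:R by rewrite divr_ge0.
  by move: (B / _) => p p0; lra.
have inv_cvg : B / (k + N)%:R @[k --> \oo] --> (B * 0 : R).
  apply: cvgMr.
  have := @cvg_harmonic R; rewrite -(cvg_shiftn N.-1).
  by apply: cvg_trans; apply: near_eq_cvg; near=> k; rewrite /= -addnS prednK.
apply/cvg_ex; exists (limn y + B * 0).
rewrite -(cvg_shiftn N).
apply: cvg_trans (cvgD y_cvg inv_cvg); apply: near_eq_cvg; near=> k.
by rewrite [LHS]addrNK.
Unshelve. all: by end_near. Qed.

End RealSequence.

Section ComplexSequence.
Variable R : realType.
Local Notation C := R[i].
Import Normc.
Implicit Types z w : C.

Lemma normrc z : `|z| = (normc z)%:C%C.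
Proof. by []. Qed.

Lemma normc_ge0 z : 0 <= normc z.
Proof. by rewrite -lecR -normrc normr_ge0. Qed.

Lemma ler_normcD z w : normc (z + w) <= normc z + normc w.
Proof. by rewrite -lecR rmorphD /= -!normrc ler_normD. Qed.

Lemma normcN z : normc (- z) = normc z.
Proof. by apply: complexI; rewrite -!normrc normrN. Qed.

Lemma normc_real (x : R) : normc x%:C%C = `|x|.
Proof. by rewrite /normc /= expr0n /= addr0 sqrtr_sqr. Qed.

Lemma normc_nat n : normc (n%:R : C) = n%:R.
Proof. by apply: complexI; rewrite -normrc normr_nat rmorph_nat. Qed.

Lemma normc_eq0 z : (normc z == 0) = (z == 0).
Proof. by apply/eqP/eqP => [/eq0_normc//|->]; rewrite (normc_real 0) normr0. Qed.

Lemma Re_le_normc z : `|complex.Re z| <= normc z.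
Proof.
case: z => a b /=; rewrite -(sqrtr_sqr a) ler_sqrt ?addr_ge0 ?sqr_ge0//.
by rewrite lerDl sqr_ge0.
Qed.

Lemma Im_le_normc z : `|complex.Im z| <= normc z.
Proof.
case: z => a b /=; rewrite -(sqrtr_sqr b) ler_sqrt ?addr_ge0 ?sqr_ge0//.
by rewrite lerDr sqr_ge0.
Qed.

Lemma normc_le_ReIm z : normc z <= `|complex.Re z| + `|complex.Im z|.
Proof.
case: z => a b /=; rewrite -(@ger0_norm _ (`|a| + `|b|)) ?addr_ge0//.
rewrite -sqrtr_sqr ler_sqrt ?sqr_ge0// sqrrD !real_normK ?num_real//.
by rewrite -addrA lerD2l lerDr mulrn_wge0 ?mulr_ge0.
Qed.

Lemma cvg_ReIm (b : nat -> C^o) (x y : R) :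
  complex.Re (b n) @[n --> \oo] --> x -> complex.Im (b n) @[n --> \oo] --> y ->
  b n @[n --> \oo] --> ((x +i* y)%C : C^o).
Proof.
move=> /cvgrPdist_lt bx /cvgrPdist_lt by_; apply/cvgrPdist_lt => -[e e'].
rewrite ltcE /= => /andP[/eqP -> e0].
have e20 : 0 < e / 2 by rewrite divr_gt0.
near=> n.
rewrite normrc ltcR (le_lt_trans (normc_le_ReIm _))//.
have -> : complex.Re (x +i* y - b n)%C = x - complex.Re (b n) by case: (b n).
have -> : complex.Im (x +i* y - b n)%C = y - complex.Im (b n) by case: (b n).
rewrite (splitr e) ltrD//; near: n; [exact: bx | exact: by_].
Unshelve. all: by end_near. Qed.

(** Convergence of an infinite product whose factors are 1 + O(1/n^2): the
    partial products b stay bounded, by the inequality 1 + t <= expR t, and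
    then their increments are summable. *)
Lemma cvg_partial_products (b : nat -> C^o) (A : R) N : 0 <= A -> (0 < N)%N ->
  (forall n, (N <= n)%N ->
     normc (b n.+1 - b n) <= A * (n%:R * n.+1%:R)^-1 * normc (b n)) ->
  cvgn b.
Proof.
move=> A0 N0 bA.
pose M := normc (b N) * expR (A / N%:R).
have bM n : (N <= n)%N -> normc (b n) <= M.
  move=> Nn.
  suff H k : normc (b (k + N)%N) <=
      normc (b N) * expR (A / N%:R - A / (k + N)%:R).
    rewrite -(subnK Nn) (le_trans (H _))// /M ler_wpM2l ?normc_ge0//.
    by rewrite ler_expR gerBl divr_ge0.
  elim: k => [|k ih]; first by rewrite add0n subrr expR0 mulr1.
  have kN : (0 < k + N)%N by rewrite addn_gt0 N0 orbT.
  have := bA _ (leq_addl k N); rewrite addSn => h.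
  rewrite -[b _.+1](subrK (b (k + N)%N)) (le_trans (ler_normcD _ _))//.
  rewrite (le_trans (lerD h (lexx _)))// telescope_inv//.
  set t := A * _.
  have -> : A / N%:R - A / (k + N).+1%:R = t + (A / N%:R - A / (k + N)%:R).
    by rewrite /t; ring.
  rewrite expRD [expR t * _]mulrC mulrA.
  rewrite -[X in _ + X]mul1r -mulrDl [leLHS]mulrC.
  have t0 : 0 <= t.
    by rewrite /t -telescope_inv// mulr_ge0// invr_ge0 mulr_ge0.
  rewrite ler_pM ?normc_ge0 ?addr_ge0//.
  by rewrite addrC expR_ge1Dx.
have steps n : (N <= n)%N ->
    normc (b n.+1 - b n) <= A * M * (n%:R * n.+1%:R)^-1.
  move=> Nn; rewrite (le_trans (bA _ Nn))// mulrAC.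
  by rewrite ler_wpM2r ?invr_ge0 ?mulr_ge0// ler_wpM2l ?bM.
have AM0 : 0 <= A * M by rewrite mulr_ge0// mulr_ge0 ?normc_ge0 ?expR_ge0.
have /cvg_ex[x bx] : cvgn (fun n => complex.Re (b n)).
  apply: (cvg_small_steps AM0 N0) => n Nn; apply: le_trans (steps _ Nn).
  by have := Re_le_normc (b n.+1 - b n); case: (b n) (b n.+1) => ? ? [? ?].
have /cvg_ex[y by_] : cvgn (fun n => complex.Im (b n)).
  apply: (cvg_small_steps AM0 N0) => n Nn; apply: le_trans (steps _ Nn).
  by have := Im_le_normc (b n.+1 - b n); case: (b n) (b n.+1) => ? ? [? ?].
by apply/cvg_ex; exists (x +i* y)%C; exact: cvg_ReIm.
Qed.

End ComplexSequence.
(** * Convergence and functional equation of Gauss's limit *)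

Section Gamma.
Variable R : realType.
Local Notation C := R[i].
Import Normc.
Implicit Types z w : C.

Lemma cexpD z w : cexp (z + w) = cexp z * cexp w.
Proof.
case: z w => a b [c d]; rewrite /cexp /= expRD cosD sinD.
by apply/eqP; rewrite eq_complex /=; apply/andP; split; apply/eqP; ring.
Qed.

Lemma normc_cexp z : normc (cexp z) = expR (complex.Re z).
Proof.
rewrite /cexp normcM normc_real ger0_norm ?expR_ge0// /normc.
by rewrite cos2Dsin2 sqrtr1 mulr1.
Qed.

Lemma cexp_neq0 z : cexp z != 0.
Proof. by rewrite -normc_eq0 normc_cexp expR_eq0. Qed.

(** Real and imaginary part of the error each split into two terms, bounded by
    2 |w|^2. *)
Lemma cexp_taylor w : normc w <= 2^-1 ->
  normc (cexp w - 1 - w) <= 8 * normc w ^+ 2.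
Proof.
move=> w2; set r := normc w in w2 *.
have r0 : 0 <= r := normc_ge0 w.
have xr : `|complex.Re w| <= r := Re_le_normc w.
have yr : `|complex.Im w| <= r := Im_le_normc w.
apply: le_trans (normc_le_ReIm _) _; rewrite /cexp.
case: w @r w2 r0 xr yr => x y r w2 r0 /= xr yr.
rewrite !(mul0r, subr0, addr0).
have [s2 s3] := trig_taylor y.
have [e1 e2] := expR_taylor (le_trans xr w2).
have e3 : expR x <= 2.
  by move: e1 (le_trans xr w2) => /[!ler_norml] /andP[_ h] h'; lra.
have x2 : x ^+ 2 <= r ^+ 2 by rewrite -real_normK ?num_real// ler_sqr ?nnegrE.
have y2 : y ^+ 2 <= r ^+ 2 by rewrite -real_normK ?num_real// ler_sqr ?nnegrE.
have -> : expR x * cos y - 1 - x = (expR x - 1 - x) + expR x * (cos y - 1) by ring.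
have -> : expR x * sin y - y = expR x * (sin y - y) + (expR x - 1) * y by ring.
have n1 := ler_normD (expR x - 1 - x) (expR x * (cos y - 1)).
have n2 := ler_normD (expR x * (sin y - y)) ((expR x - 1) * y).
rewrite !normrM (ger0_norm (expR_ge0 x)) in n1 n2.
have m1 : expR x * `|cos y - 1| <= 2 * r ^+ 2.
  by rewrite ler_pM ?expR_ge0// (le_trans s2).
have m2 : expR x * `|sin y - y| <= 2 * r ^+ 2.
  by rewrite ler_pM ?expR_ge0// (le_trans s3).
have m3 : `|expR x - 1| * `|y| <= 2 * r ^+ 2.
  by rewrite expr2 mulrA ler_pM// (le_trans e1)// ler_wpM2l.
lra.
Qed.

(** Membership in the domain of Gamma: z is not one of 0, -1, -2, ... *)
Definition nonpole z := forall n : nat, z + n%:R != 0.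

Definition ln_incr n : R := ln n.+1%:R - ln n%:R.

Lemma prod_nonpole z n : nonpole z -> \prod_(0 <= i < n) (z + i%:R) != 0.
Proof. by move=> zP; rewrite prodf_seq_neq0; apply/allP => i _; exact: zP. Qed.

Lemma gauss_seqS z n : nonpole z -> (0 < n)%N ->
  gauss_seq z n.+1 * (z + n.+1%:R) =
  gauss_seq z n * (n.+1%:R * cexp (z * (ln_incr n)%:C%C)).
Proof.
move=> zP n0; rewrite /gauss_seq big_nat_recr//= factS natrM /natcpow.
have -> : z * (ln n.+1%:R)%:C%C = z * (ln n%:R)%:C%C + z * (ln_incr n)%:C%C.
  by rewrite -mulrDr /ln_incr -rmorphD /= addrC subrK.
have p0 := prod_nonpole n.+1 zP.
rewrite cexpD; move: (zP n.+1) p0; move: (z + _) (\prod_(_ <= _ < _) _) => d p d0 p0.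
by field; rewrite d0 p0.
Qed.

Lemma gauss_seq_neq0 z n : nonpole z -> gauss_seq z n != 0.
Proof.
move=> zP; apply: mulf_neq0; last by rewrite invr_eq0 prod_nonpole.
by rewrite mulf_neq0 ?cexp_neq0// pnatr_eq0 -lt0n fact_gt0.
Qed.

(** By [gauss_seqS], the relative increment of Gauss's sequence at n is
    [ratio_err z n] divided by z + n + 1.  It is O(1/n), so that the increment
    is O(1/n^2); [ratio_bound z] is an admissible constant in this O(1/n), valid
    from the index [ratio_start z] on, where |z| / n <= 1/2 allows the use of
    [cexp_taylor]; its 16 is the 8 of that lemma times a bound for (n + 1) / n. *)
Definition ratio_err z n : C := n.+1%:R * (cexp (z * (ln_incr n)%:C%C) - 1) - z.

Definition ratio_bound z : R := 16 * normc z ^+ 2 + normc z.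

Definition ratio_start z : nat := (Num.truncn (2 * normc z)).+1.

Lemma normc_ln_incr z n : (ratio_start z <= n)%N ->
  normc (z * (ln_incr n)%:C%C) <= normc z / n%:R <= 2^-1.
Proof.
move=> zn; have n0 : (0 < n)%N by exact: leq_trans zn.
have nR : (0 : R) < n%:R by rewrite ltr0n.
have /andP[l1 l2] := ln_succ_sub_bounds R n0.
have l0 : 0 <= ln_incr n by rewrite (le_trans _ l1)// invr_ge0.
rewrite normcM normc_real (ger0_norm l0) ler_wpM2l ?normc_ge0//=.
rewrite ler_pdivrMr// -ler_pdivrMl ?invr_gt0// invrK.
rewrite (le_trans (ltW (truncnS_gt _)))//.
by rewrite ler_nat.
Qed.

Lemma ratio_err_le z n : (ratio_start z <= n)%N ->
  normc (ratio_err z n) <= ratio_bound z / n%:R.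
Proof.
move=> zn; have n0 : (0 < n)%N by exact: leq_trans zn.
have nR : (0 : R) < n%:R by rewrite ltr0n.
have /andP[h1 h2] := normc_ln_incr zn.
have /andP[l1 l2] := ln_succ_sub_bounds R n0.
have z0 := normc_ge0 z.
set w := z * _ in h1.
have -> : ratio_err z n =
    n.+1%:R * (cexp w - 1 - w) + z * (n.+1%:R * ln_incr n - 1)%:C%C.
  by rewrite /ratio_err -/w rmorphB rmorphM rmorph_nat /= /w; ring.
apply: le_trans (ler_normcD _ _) _; rewrite !normcM normc_nat normc_real.
have t1 : normc (cexp w - 1 - w) <= 8 * (normc z / n%:R) ^+ 2.
  rewrite (le_trans (cexp_taylor (le_trans h1 h2)))//.
  by rewrite ler_wpM2l// ler_sqr ?nnegrE ?normc_ge0// (le_trans _ h1)// normc_ge0.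
have n2 : n.+1%:R <= 2 * n%:R :> R.
  by rewrite -natrM ler_nat mul2n -addnn -addn1 leq_add2l.
have t2 : n.+1%:R * normc (cexp w - 1 - w) <= 16 * normc z ^+ 2 / n%:R.
  have -> : 16 * normc z ^+ 2 / n%:R = (2 * n%:R) * (8 * (normc z / n%:R) ^+ 2).
    by field; rewrite gt_eqF.
  by rewrite ler_pM ?normc_ge0.
have t3 : `|n.+1%:R * ln_incr n - 1| <= n%:R^-1.
  rewrite ler_norml; apply/andP; split.
    rewrite (@le_trans _ _ 0) ?oppr_le0 ?invr_ge0// subr_ge0.
    by rewrite mulrC -ler_pdivrMr ?ltr0n// div1r.
  rewrite lerBlDl.
  have -> : 1 + n%:R^-1 = n.+1%:R * n%:R^-1 :> R.
    by rewrite -natr1; field; rewrite gt_eqF.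
  by rewrite ler_wpM2l.
by rewrite /ratio_bound mulrDl lerD// ler_wpM2l.
Qed.

Lemma ratio_bound_ge0 z : 0 <= 2 * ratio_bound z.
Proof. by rewrite mulr_ge0// addr_ge0 ?mulr_ge0 ?exprn_ge0 ?normc_ge0. Qed.

(** The constant is doubled because |z + n + 1| >= (n + 1) / 2 from the index
    [ratio_start z] on. *)
Lemma gauss_seq_cvg z : nonpole z -> cvgn (gauss_seq z).
Proof.
move=> zP; apply: (@cvg_partial_products _ _ (2 * ratio_bound z) (ratio_start z)) => //.
  exact: ratio_bound_ge0.
move=> n zn; have n0 : (0 < n)%N by exact: leq_trans zn.
have nR : (0 : R) < n%:R by rewrite ltr0n.
have d0 : z + n.+1%:R != 0 by exact: zP.
have -> : gauss_seq z n.+1 - gauss_seq z n =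
    ratio_err z n / (z + n.+1%:R) * gauss_seq z n.
  apply: (mulIf d0); rewrite mulrBl gauss_seqS// /ratio_err.
  move: (gauss_seq z n) (n.+1%:R : C) (cexp _) d0 => a m E d0.
  by field.
rewrite normcM ler_wpM2r ?normc_ge0// normcM normcV.
have h : 2^-1 * n.+1%:R <= normc (z + n.+1%:R).
  have := ler_normcD (z + n.+1%:R) (- z).
  rewrite addrAC subrr add0r normc_nat normcN.
  have : 2 * normc z <= n.+1%:R.
    by rewrite (le_trans (ltW (truncnS_gt _)))// ler_nat (leq_trans zn).
  move: (n.+1%:R) (normc z) (normc _) => p q s; lra.
have h0 : (0 : R) < 2^-1 * n.+1%:R by rewrite mulr_gt0 ?invr_gt0 ?ltr0n.
have -> : 2 * ratio_bound z * (n%:R * n.+1%:R)^-1 =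
    ratio_bound z / n%:R * (2^-1 * n.+1%:R)^-1.
  by rewrite !invfM invrK; ring.
rewrite ler_pM ?normc_ge0 ?invr_ge0 ?normc_ge0 ?ratio_err_le//.
by rewrite lef_pV2 ?posrE ?(lt_le_trans h0).
Qed.

(** The inverse sequence also consists of partial products with factors
    1 + O(1/n^2); this is what forces the limit of Gauss's sequence to be
    nonzero. *)
Lemma inv_gauss_seq_cvg z : nonpole z -> cvgn (fun n => (gauss_seq z n)^-1 : C^o).
Proof.
move=> zP; apply: (@cvg_partial_products _ _ (2 * ratio_bound z) (ratio_start z)) => //.
  exact: ratio_bound_ge0.
move=> n zn; have n0 : (0 < n)%N by exact: leq_trans zn.
have nR : (0 : R) < n%:R by rewrite ltr0n.
have d0 : z + n.+1%:R != 0 by exact: zP.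
have g0 := gauss_seq_neq0 n zP; have g1 := gauss_seq_neq0 n.+1 zP.
have E0 := cexp_neq0 (z * (ln_incr n)%:C%C).
have -> : (gauss_seq z n.+1)^-1 - (gauss_seq z n)^-1 =
    - (ratio_err z n / (n.+1%:R * cexp (z * (ln_incr n)%:C%C))) * (gauss_seq z n)^-1.
  have -> : gauss_seq z n.+1 =
     gauss_seq z n * (n.+1%:R * cexp (z * (ln_incr n)%:C%C)) / (z + n.+1%:R).
    by rewrite -gauss_seqS// mulfK.
  rewrite /ratio_err.
  have m0 : (n.+1%:R : C) != 0 by rewrite pnatr_eq0.
  move: (gauss_seq z n) (n.+1%:R : C) (cexp _) d0 g0 E0 m0 => a m E d0 g0 E0 m0.
  by field; rewrite d0 g0 E0 m0.
rewrite normcM ler_wpM2r ?normc_ge0// normcN normcM normcV normcM normc_nat.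
have h : 2^-1 <= normc (cexp (z * (ln_incr n)%:C%C)).
  rewrite normc_cexp (le_trans _ (expR_ge1Dx _))//.
  have /andP[h1 h2] := normc_ln_incr zn.
  have := le_trans (Re_le_normc _) (le_trans h1 h2).
  rewrite ler_norml => /andP[h3 _]; lra.
have h0 : (0 : R) < 2^-1 * n.+1%:R by rewrite mulr_gt0 ?invr_gt0 ?ltr0n.
have -> : 2 * ratio_bound z * (n%:R * n.+1%:R)^-1 =
    ratio_bound z / n%:R * (2^-1 * n.+1%:R)^-1.
  by rewrite !invfM invrK; ring.
rewrite ler_pM ?normc_ge0 ?invr_ge0 ?mulr_ge0 ?normc_ge0 ?ratio_err_le//.
rewrite lef_pV2 ?posrE//; first by rewrite mulrC ler_wpM2l.
by rewrite mulr_gt0// (lt_le_trans _ h)// invr_gt0.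
Qed.

(** Limits live in C^o, whereas products of values are taken in C; the two
    multiplications are convertible. *)
Lemma cvgMC (f g : nat -> C^o) (a b : C) :
  f @ \oo --> (a : C^o) -> g @ \oo --> (b : C^o) ->
  (fun n => (f n : C) * (g n : C) : C^o) @ \oo --> (a * b : C^o).
Proof. by move=> fa gb; have := cvgM fa gb; apply. Qed.

Lemma Gamma_neq0 z : nonpole z -> Gamma z != 0.
Proof.
move=> zP; have c1 : gauss_seq z @ \oo --> (Gamma z : C^o) := gauss_seq_cvg zP.
have /cvg_ex[l c2] := inv_gauss_seq_cvg zP.
have h0 : (gauss_seq z n * (gauss_seq z n)^-1 : C^o) @[n --> \oo] -->
    (Gamma z * l : C^o) by exact: cvgMC c1 c2.
have h1 : (gauss_seq z n * (gauss_seq z n)^-1 : C^o) @[n --> \oo] --> (1 : C^o).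
  by apply: cvg_near_cst; apply: nearW => n; rewrite mulfV// gauss_seq_neq0.
have e : (1 : C) = Gamma z * l := cvg_unique (@norm_hausdorff _ C^o) h1 h0.
by apply/negP => /eqP G0; have := oner_neq0 C; rewrite e G0 mul0r eqxx.
Qed.

Lemma shift_ratio_cvg z : nonpole z ->
  (n%:R / (z + n.+1%:R) : C^o) @[n --> \oo] --> (1 : C^o).
Proof.
move=> zP; apply/cvgrPdist_lt => -[e e'].
rewrite ltcE /= => /andP[/eqP -> e0].
near=> n.
have -> : 1 - n%:R / (z + n.+1%:R) = (z + 1) / (z + n.+1%:R).
  have := zP n.+1; rewrite -natr1 addrA; move: (n%:R : C) => m d0.
  by field.
rewrite normrc ltcR normcM normcV.
have h : 2^-1 * n.+1%:R <= normc (z + n.+1%:R).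
  have := ler_normcD (z + n.+1%:R) (- z).
  rewrite addrAC subrr add0r normc_nat normcN.
  have : 2 * normc z <= n.+1%:R.
    rewrite (le_trans (ltW (truncnS_gt _)))// ler_nat ltnS.
    by near: n; exact: nbhs_infty_ge.
  move: (n.+1%:R) (normc z) (normc _) => p q s; lra.
have h0 : (0 : R) < 2^-1 * n.+1%:R by rewrite mulr_gt0 ?invr_gt0 ?ltr0n.
rewrite ltr_pdivrMr ?(lt_le_trans h0)// (lt_le_trans _ (ler_wpM2l (ltW e0) h))//.
rewrite mulrA -ltr_pdivrMl ?mulr_gt0 ?invr_gt0//.
rewrite (lt_trans (truncnS_gt _))// ltr_nat ltnS.
by near: n; exact: nbhs_infty_gt.
Unshelve. all: by end_near. Qed.

Lemma gauss_seq_shift z n : nonpole z -> (0 < n)%N ->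
  gauss_seq (z + 1) n = gauss_seq z n * (n%:R / (z + n.+1%:R)) * z.
Proof.
move=> zP n0; rewrite /gauss_seq /natcpow mulrDl mul1r cexpD.
have -> : cexp (ln n%:R)%:C%C = n%:R :> C.
  by rewrite /cexp /= cos0 sin0 mulr1 lnK ?posrE ?ltr0n// rmorph_nat.
have z0 : z != 0 by have := zP 0%N; rewrite addr0.
have -> : \prod_(0 <= i < n.+1) (z + 1 + i%:R) =
    (\prod_(0 <= i < n.+1) (z + i%:R)) * (z + n.+1%:R) / z.
  rewrite -[X in X / z](@big_nat_recr _ _ _ n.+1 0 (fun i => z + i%:R))//.
  rewrite [in RHS]big_nat_recl//= addr0 [RHS]mulrAC mulfV// mul1r.
  by apply: eq_bigr => i _; rewrite -addrA nat1r.
have p0 := prod_nonpole n.+1 zP.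
move: (zP n.+1) p0; move: (z + _%:R) (\prod_(_ <= _ < _) _) => d p d0 p0.
by field; rewrite d0 p0.
Qed.

(** Passing from z to z + 1 multiplies the n-th term of Gauss's sequence by
    z n / (z + n + 1), which tends to z. *)
Lemma GammaS z : nonpole z -> Gamma (z + 1) = z * Gamma z.
Proof.
move=> zP; rewrite mulrC.
have c1 : gauss_seq z @ \oo --> (Gamma z : C^o) := gauss_seq_cvg zP.
have c2 : (fun=> z : C^o) @ \oo --> (z : C^o) by exact: cvg_cst.
have := cvgMC (cvgMC c1 (shift_ratio_cvg zP)) c2; rewrite mulr1 => lim_prod.
suff : gauss_seq (z + 1) @ \oo --> (Gamma z * z : C^o).
  by move/(cvg_lim (@norm_hausdorff _ C^o)).
apply: cvg_trans lim_prod; apply: near_eq_cvg; near=> n.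
rewrite gauss_seq_shift//; near: n; exact: nbhs_infty_gt.
Unshelve. all: by end_near. Qed.

End Gamma.
End GammaFacts.

Import mpoly.

(** * Commutation relations characterising the solutions *)

(** The operators X, Y, Dx, Dy stand for multiplication by z1 and z21 and for
    the partial derivatives in the coordinates (z1, z21); [euler b] stands for
    the Euler operator z21 d/dz21 plus the scalar b.  Keeping them abstract
    isolates the linear algebra of the problem from polynomials. *)
Section AbstractIntertwiner.
Variables (K : fieldType) (V : lmodType K) (X Y Dx Dy : {linear V -> V}).
Variable euler : K -> {linear V -> V}.
Hypothesis eulerD : forall a b p, euler (a + b) p = euler a p + b *: p.
Implicit Types (a b c d : K) (p : V) (T : {linear V -> V}).

(** The entries of L1(a,b) L2(c,d) in these coordinates, where the part of the
    second row with coefficient b is separated: the second row of the product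
    is X times its first row plus b times [row2_col1], [row2_col2]. *)
Definition row1_col1 a c d p : V :=
  X (euler (a - d) (Dy p)) - Y (euler (c - d) (Dx p))
  + ((a * c) *: p + (a + c - d) *: euler 0 p + euler 0 (euler 0 p) - euler 0 p
     - X (euler (- d) (Dx p))).

Definition row1_col2 a d p : V := euler (- d) (Dx p) - euler (a - d) (Dy p).

Definition row2_col1 c d p : V := X (euler (- d) p) + Y (euler (c - d) p).

Definition row2_col2 d p : V := - euler (- d) p.

(** The content of the defining equation with (a, c, d) = (u1, v1, v2): apart
    from commuting with z1, with d/dz1 at fixed z21 and with the Euler operator,
    T only has to satisfy two relations in which a and c are exchanged. *)
Record intertwiner a c d T : Prop := Intertwiner {
  twX : forall p, T (X p) = X (T p);
  twDx : forall p, T (Dx p) = Dx (T p);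
  twN : forall b p, T (euler b p) = euler b (T p);
  twY : forall p, T (Y (euler (c - d) p)) = Y (euler (a - d) (T p));
  twDy : forall p, T (euler (a - d) (Dy p)) = euler (c - d) (Dy (T p))
}.

Record intertwines_rows a b c d T : Prop := IntertwinesRows {
  tw11 : forall p, T (row1_col1 a c d p) = row1_col1 c a d (T p);
  tw12 : forall p, T (row1_col2 a d p) = row1_col2 c d (T p);
  tw21 : forall p, T (X (row1_col1 a c d p) + b *: row2_col1 c d p) =
                   X (row1_col1 c a d (T p)) + b *: row2_col1 a d (T p);
  tw22 : forall p, T (X (row1_col2 a d p) + b *: row2_col2 d p) =
                   X (row1_col2 c d (T p)) + b *: row2_col2 d (T p)
}.

Lemma intertwiner_rows a b c d T :
  intertwiner a c d T -> intertwines_rows a b c d T.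
Proof.
case=> TX TDx TN TY TDy.
have T11 p : T (row1_col1 a c d p) = row1_col1 c a d (T p).
  rewrite /row1_col1 !(linearD, linearN, linearZ, TX) /= TDy TY !TN !TDx.
  by rewrite [c * a]mulrC [c + a]addrC.
have T12 p : T (row1_col2 a d p) = row1_col2 c d (T p).
  by rewrite /row1_col2 linearB TN TDx TDy.
split=> // p; rewrite linearD linearZ TX ?T11 ?T12; congr (_ + _ *: _).
- by rewrite /row2_col1 linearD TX TN TY.
- by rewrite /row2_col2 linearN TN.
Qed.

(** The equations are affine in b with T independent of b, so two values of b
    separate the two parts of the second row.  Likewise T does not change when
    a, c, d are shifted together, and only the terms in d alone see this shift:
    comparing a shift by 0 with a shift by 1 isolates T X = X T and
    T Dx = Dx T. *)
Lemma rows_intertwiner a b c d T :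
  (forall l m : bool,
     intertwines_rows (a + l%:R) (b + m%:R) (c + l%:R) (d + l%:R) T) ->
  intertwiner a c d T.
Proof.
move=> H.
have sh (l : bool) u v : u + l%:R - (v + l%:R) = u - v.
  by rewrite opprD addrACA subrr addr0.
have es (l : bool) p : euler (- (d + l%:R)) p = euler (- d) p - l%:R *: p.
  by rewrite opprD eulerD scaleNr.
have E12 (l : bool) p := tw12 (H l false) p.
have addK u u' v v' : T u = u' -> T (u + v) = u' + v' -> T v = v'.
  by move=> Tu; rewrite linearD Tu => /addrI.
have subK u u' v v' : T u = u' -> T (u - v) = u' - v' -> T v = v'.
  by move=> Tu; rewrite linearB Tu => /addrI/oppr_inj.
have E21 (l : bool) p : T (row2_col1 (c + l%:R) (d + l%:R) p) =
    row2_col1 (a + l%:R) (d + l%:R) (T p).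
  apply: addK (tw21 (H l false) p) _.
  by have := tw21 (H l true) p; rewrite addr0 scalerDl scalerDl scale1r scale1r !addrA.
have E22 p : T (row2_col2 (d + false%:R) p) = row2_col2 (d + false%:R) (T p).
  apply: addK (tw22 (H false false) p) _.
  have := tw22 (H false true) p.
  by rewrite [b + false%:R]addr0 scalerDl scalerDl scale1r scale1r !addrA.
have Tm p : T (euler (- d) p) = euler (- d) (T p).
  by apply: oppr_inj; have := E22 p; rewrite /row2_col2 addr0 linearN.
have TN e p : T (euler e p) = euler e (T p).
  by rewrite -[e](addKr d) !(eulerD (- d)) linearD linearZ Tm.
have TX p : T (X p) = X (T p).
  apply: subK (E21 false p) _; have := E21 true p.
  rewrite /row2_col1 !sh !es !scale0r !scale1r !subr0 !(linearB X) /=.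
  by rewrite addrAC [X in _ = X -> _]addrAC.
have TDx p : T (Dx p) = Dx (T p).
  apply: subK (E12 false p) _; have := E12 true p.
  rewrite /row1_col2 !sh !es !scale0r !subr0 !scale1r.
  by rewrite addrAC [X in _ = X -> _]addrAC.
split=> // p.
- have := E21 false p; rewrite /row2_col1 !sh !addr0.
  by apply: addK; rewrite TX TN.
- have := E12 false p; rewrite /row1_col2 !sh !addr0.
  by apply: subK; rewrite TN TDx.
Qed.

(** Below, [e j k] stands for z1^j z21^k. *)
Variable e : nat -> nat -> V.
Hypotheses (eP : forall S T : {linear V -> V},
    (forall j k, S (e j k) = T (e j k)) -> S =1 T)
  (Xe : forall j k, X (e j k) = e j.+1 k)
  (Ye : forall j k, Y (e j k) = e j k.+1)
  (Dxe : forall j k, Dx (e j k) = j%:R *: e j.-1 k)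
  (Dye : forall j k, Dy (e j k) = k%:R *: e j k.-1)
  (eulere : forall b j k, euler b (e j k) = (k%:R + b) *: e j k).

Lemma diag_intertwiner a c d (f : nat -> K) T :
  (forall j k, T (e j k) = f k *: e j k) ->
  (forall k, f k.+1 * (k%:R + (c - d)) = f k * (k%:R + (a - d))) ->
  intertwiner a c d T.
Proof.
move=> Te fS; split.
- apply: (eP (S := T \o X) (T := X \o T)) => j k /=.
  by rewrite Te linearZ /= Xe Te.
- apply: (eP (S := T \o Dx) (T := Dx \o T)) => j k /=.
  by rewrite Te linearZ /= Dxe linearZ /= Te !scalerA mulrC.
- move=> b; apply: (eP (S := T \o euler b) (T := euler b \o T)) => j k /=.
  by rewrite Te linearZ /= eulere linearZ /= Te !scalerA mulrC.
- apply: (eP (S := T \o Y \o euler (c - d))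
             (T := Y \o euler (a - d) \o T)) => j k /=.
  by rewrite Te eulere !linearZ /= eulere linearZ /= Ye Te !scalerA mulrC fS.
- apply: (eP (S := T \o euler (a - d) \o Dy)
             (T := euler (c - d) \o Dy \o T)) => j k /=.
  rewrite Te Dye !linearZ /= Dye linearZ /=.
  case: k => [|k]; first by rewrite !scale0r scaler0.
  rewrite /= !eulere !linearZ /= Te !scalerA; congr (_ *: _).
  transitivity (k.+1%:R * (f k * (k%:R + (a - d)))); first by ring.
  by rewrite -fS; ring.
Qed.

Let linZ T s p : T (s *: p) = s *: T p. Proof. exact: linearZ. Qed.

Hypothesis e_const :
  forall p, Dx p = 0 -> euler 0 p = 0 -> exists s, p = s *: e 0 0.

(** T (e 0 0) is killed by Dx and by the Euler operator, hence is a multiple of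
    e 0 0.  Commutation with X propagates this along j, and the relation for Y
    is a recursion along k, which can be solved because k + c - d never
    vanishes. *)
Lemma intertwiner_diag a c d (f : nat -> K) T :
  (forall k, k%:R + (c - d) != 0) -> f 0%N != 0 ->
  (forall k, f k.+1 * (k%:R + (c - d)) = f k * (k%:R + (a - d))) ->
  intertwiner a c d T ->
  exists s, forall j k, T (e j k) = s *: (f k *: e j k).
Proof.
move=> cd0 f0 fS [TX TDx TN TY _].
have [||s Ts] := @e_const (T (e 0 0)).
- by rewrite -TDx Dxe scale0r linear0.
- by rewrite -TN eulere addr0 scale0r linear0.
exists (s / f 0%N) => j k; elim: j => [|j ih]; last first.
  by rewrite -Xe TX ih linearZ /= linearZ /=.
elim: k => [|k ih]; first by rewrite Ts scalerA divfK.
have := TY (e 0 k); rewrite eulere linearZ /= linearZ /= Ye.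
rewrite ih !(linZ (euler _)) /= eulere !(linZ Y) /= Ye.
rewrite [X in s / _ *: X]scalerA -fS => h.
apply: (scalerI (cd0 k)); rewrite h !scalerA.
by congr (_ *: _); ring.
Qed.

End AbstractIntertwiner.

(** * Entries of the product of the two Lax operators *)

(** The computation only uses that d1 and d2 are commuting derivations dual to
    x1 and x2, so it takes place in any commutative algebra.  There dx and d2
    are the partial derivatives in the coordinates (x1, y), and eu 0 is the
    Euler operator y d/dy. *)
Section LaxAlgebra.
Variables (K : comNzRingType) (A : comAlgType K) (d1 d2 : {linear A -> A}).
Variables (x1 x2 : A).
Hypotheses (d1M : forall p q, d1 (p * q) = d1 p * q + p * d1 q)
           (d2M : forall p q, d2 (p * q) = d2 p * q + p * d2 q)
           (d12 : forall p, d1 (d2 p) = d2 (d1 p))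
           (d1x2 : d1 x2 = 0)
           (d2x1 : d2 x1 = 0) (d2x2 : d2 x2 = 1).
Implicit Types (a b c d : K) (p q : A).
Let y := x2 - x1.
Let dx p := d1 p + d2 p.
Let eu c p := y * d2 p + c *: p.

(* scalings are turned into products, which [ring] can normalise *)
Lemma scale_in_alg a p : a *: p = in_alg A a * p.
Proof. by rewrite mulr_algl. Qed.

Lemma lax12 a d p :
  a *: (- d2 p) + x1 * d1 (- d2 p) + (- d1 (d *: p - x2 * d2 p)) =
  eu (- d) (dx p) - eu (a - d) (d2 p).
Proof.
rewrite /eu /dx /y !(linearB, linearN, linearD, linearZ, d1M, d2M) /= d1x2 d12.
by rewrite !scale_in_alg; ring.
Qed.

Lemma lax11 a c d p :
  a *: (c *: p + x2 * d2 p) + x1 * d1 (c *: p + x2 * d2 p)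
   - d1 (x2 ^+ 2 * d2 p + (c - d) *: (x2 * p)) =
  x1 * (eu (a - d) (d2 p)) - y * (eu (c - d) (dx p))
  + ((a * c) *: p + (a + c - d) *: eu 0 p + eu 0 (eu 0 p) - eu 0 p
     - x1 * (eu (- d) (dx p))).
Proof.
rewrite /eu /dx /y expr2.
rewrite !(linearB, linearN, linearD, linearZ, d1M, d2M, scale0r, addr0) /=.
by rewrite d1x2 d2x1 d2x2 !d12 !scale_in_alg; ring.
Qed.

(** The second row of L1(a,b) is x1 times its first row plus b (- x1, 1). *)
Lemma lax_row2 a b q1 q2 :
  x1 ^+ 2 * d1 q1 + (a - b) *: (x1 * q1) + (b *: q2 - x1 * d1 q2) =
  x1 * (a *: q1 + x1 * d1 q1 - d1 q2) + b *: (q2 - x1 * q1).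
Proof. by rewrite !scale_in_alg; ring. Qed.

(** The entries of (- x1, 1) times L2(c,d). *)
Lemma lax_kernel1 c d p :
  x2 ^+ 2 * d2 p + (c - d) *: (x2 * p) - x1 * (c *: p + x2 * d2 p) =
  x1 * eu (- d) p + y * eu (c - d) p.
Proof. by rewrite /eu /y !scale_in_alg; ring. Qed.

Lemma lax_kernel2 d p : d *: p - x2 * d2 p - x1 * (- d2 p) = - eu (- d) p.
Proof. by rewrite /eu /y !scale_in_alg; ring. Qed.
End LaxAlgebra.

(** * Operators on polynomials in two variables *)

Section Polynomials.
Variable R : realType.
Local Notation C := R[i].
Local Notation P := {mpoly C[2]}.
Local Notation X := ('X_i1 : P).
Local Notation Y := (z21 R).
Implicit Types (p q : P) (a b c d : C) (j k : nat).

Definition mulp (r : P) p : P := r * p.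

(** The partial derivatives in the coordinates (z1, z21): d/dz1 at fixed z21 is
    the sum of both derivatives, d/dz21 at fixed z1 is d/dz2. *)
Definition Dx p : P := p^`M(i1) + p^`M(i2).
Definition Dy p : P := p^`M(i2).
Definition euler c p : P := Y * Dy p + c *: p.

Fact mulp_is_linear r : linear (mulp r).
Proof. by move=> c p q; rewrite /mulp mulrDr scalerAr. Qed.
HB.instance Definition _ r :=
  GRing.isLinear.Build C P P *:%R (mulp r) (mulp_is_linear r).

Fact Dx_is_linear : linear Dx.
Proof. by move=> c p q; rewrite /Dx !linearP scalerDr addrACA. Qed.
HB.instance Definition _ := GRing.isLinear.Build C P P *:%R Dx Dx_is_linear.

Fact Dy_is_linear : linear Dy.
Proof. by move=> c p q; rewrite /Dy !linearP. Qed.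
HB.instance Definition _ := GRing.isLinear.Build C P P *:%R Dy Dy_is_linear.

Fact euler_is_linear b : linear (euler b).
Proof.
move=> c p q; rewrite /euler (linearP Dy) /= mulrDr -scalerAr !scalerDr.
by rewrite !scalerA [c * b]mulrC addrACA.
Qed.
HB.instance Definition _ b :=
  GRing.isLinear.Build C P P *:%R (euler b) (euler_is_linear b).

Definition basis j k : P := X ^+ j * Y ^+ k.

(** Monomials in z1, z2 expand in z1^j z21^k because z2 = z21 + z1. *)
Lemma eq_on_basis (S T : {linear P -> P}) :
  (forall j k, S (basis j k) = T (basis j k)) -> S =1 T.
Proof.
move=> ST p; rewrite [p]mpolyE !linear_sum; apply: eq_bigr => m _.
rewrite !linearZ; congr (_ *: _).
rewrite mpolyXE_id big_ord_recl big_ord1 /=.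
have -> : lift ord0 ord0 = i2 by apply: val_inj.
rewrite -/i1; have -> : 'X_i2 = Y + X by rewrite /z21 subrK.
rewrite exprDn mulr_sumr !linear_sum; apply: eq_bigr => i _.
have -> : X ^+ m i1 * (Y ^+ (m i2 - i) * X ^+ i *+ 'C(m i2, i)) =
    basis (i + m i1) (m i2 - i) *+ 'C(m i2, i).
  by rewrite /basis exprD mulrnAr; congr (_ *+ _); ring.
by rewrite (raddfMn S) (raddfMn T); congr (_ *+ _); exact: ST.
Qed.

Lemma mderiv_exp (i : 'I_2) p n :
  (p ^+ n)^`M(i) = p ^+ n.-1 * p^`M(i) *+ n.
Proof.
elim: n => [|n ih]; first by rewrite expr0 mulr0n -mpolyC1 mderivC.
rewrite exprS mderivM ih /=; case: n {ih} => [|n].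
  by rewrite mulr0n mulr0 addr0 expr0 mulrC.
by rewrite mulrnAr mulrA -exprS [X in X + _]mulrC -mulrS.
Qed.

Lemma mderivXU (i k : 'I_2) : ('X_k : P)^`M(i) = (i == k)%:R.
Proof.
rewrite mderivX mnmE eq_sym; have [->|] := eqVneq k i; last by rewrite scale0r.
rewrite scale1r -mpolyX0; congr mpolyX; apply/mnmP => l.
by rewrite mnmBE mnm0E subnn.
Qed.

Lemma DxM p q : Dx (p * q) = Dx p * q + p * Dx q.
Proof. by rewrite /Dx !mderivM mulrDl mulrDr addrACA. Qed.

Lemma Dx_exp p k : Dx (p ^+ k) = p ^+ k.-1 * Dx p *+ k.
Proof. by rewrite /Dx !mderiv_exp mulrDr mulrnDl. Qed.

Lemma Dx_X : Dx X = 1.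
Proof. by rewrite /Dx !mderivXU /= addr0. Qed.

Lemma Dx_Y : Dx Y = 0.
Proof. by rewrite /Dx !mderivB !mderivXU /= sub0r subr0 addNr. Qed.

Lemma Dy_X : Dy X = 0.
Proof. by rewrite /Dy mderivXU. Qed.

Lemma Dy_Y : Dy Y = 1.
Proof. by rewrite /Dy mderivB !mderivXU subr0. Qed.

Lemma Dx_basis j k : Dx (basis j k) = j%:R *: basis j.-1 k.
Proof.
rewrite /basis DxM !Dx_exp Dx_X Dx_Y !(mulr0, mul0rn, addr0) mulr1.
by rewrite mulrnAl scaler_nat.
Qed.

Lemma Dy_basis j k : Dy (basis j k) = k%:R *: basis j k.-1.
Proof.
rewrite /basis /Dy mderivM !mderiv_exp -!/(Dy _) Dy_X Dy_Y.
by rewrite !(mulr0, mul0rn, mul0r) add0r mulr1 mulrnAr scaler_nat.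
Qed.

Lemma mulX_basis j k : mulp X (basis j k) = basis j.+1 k.
Proof. by rewrite /mulp /basis mulrA -exprS. Qed.

Lemma mulY_basis j k : mulp Y (basis j k) = basis j k.+1.
Proof. by rewrite /mulp /basis mulrCA -exprS. Qed.

Lemma euler_basis c j k : euler c (basis j k) = (k%:R + c) *: basis j k.
Proof.
rewrite /euler Dy_basis -scalerAr -/(mulp Y _) mulY_basis scalerDl.
by case: k => [|k] //; rewrite !scale0r.
Qed.

Local Notation LX := (mulp X : {linear P -> P}).
Local Notation LY := (mulp Y : {linear P -> P}).
Local Notation LDx := (Dx : {linear P -> P}).
Local Notation LDy := (Dy : {linear P -> P}).
Local Notation LE := (fun b => euler b : {linear P -> P}).
Local Notation row11 := (row1_col1 LX LY LDx LDy LE).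
Local Notation row12 := (row1_col2 LDx LDy LE).
Local Notation row21 := (row2_col1 LX LY LE).
Local Notation row22 := (row2_col2 LE).

Let d12 p : p^`M(i2)^`M(i1) = p^`M(i1)^`M(i2) := mderiv_comm i2 i1 p.
Let d1 : {linear P -> P} := mderiv i1.
Let d2 : {linear P -> P} := mderiv i2.
Let d1x2 : d1 'X_i2 = 0. Proof. by rewrite /d1 /= mderivXU. Qed.
Let d2x1 : d2 'X_i1 = 0. Proof. by rewrite /d2 /= mderivXU. Qed.
Let d2x2 : d2 'X_i2 = 1. Proof. by rewrite /d2 /= mderivXU. Qed.

Lemma opmx_mulE (A B : 'M[P -> P]_2) (i k : 'I_2) p :
  opmx_mul A B i k p = A i i1 (B i1 k p) + A i i2 (B i2 k p).
Proof.
rewrite mxE big_ord_recl big_ord1.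
by have -> : lift ord0 ord0 = i2 by apply: val_inj.
Qed.

Lemma LaxE (k : 'I_2) a b :
  [/\ Lax k a b i1 i1 = (fun p => a *: p + 'X_k * p^`M(k)),
      Lax k a b i1 i2 = (fun p => - p^`M(k)),
      Lax k a b i2 i1 = (fun p => 'X_k ^+ 2 * p^`M(k) + (a - b) *: ('X_k * p))
    & Lax k a b i2 i2 = (fun p => b *: p - 'X_k * p^`M(k))].
Proof. by split; rewrite mxE. Qed.

(* In the next proofs the matrices are generalised so that rewriting with
   their entries compares variables only. *)
Lemma Lax_mul11 a b c d p :
  opmx_mul (Lax i1 a b) (Lax i2 c d) i1 i1 p = row11 a c d p.
Proof.
have := LaxE i1 a b; have := LaxE i2 c d.
move: (Lax i1 a b) (Lax i2 c d) => A B [M1 M2 M3 M4] [L1 L2 _ _].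
rewrite opmx_mulE L1 L2 M1 M3.
exact: (@lax11 C P d1 d2 'X_i1 'X_i2 (mderivM i1) (mderivM i2) d12 d1x2).
Qed.

Lemma Lax_mul12 a b c d p :
  opmx_mul (Lax i1 a b) (Lax i2 c d) i1 i2 p = row12 a d p.
Proof.
have := LaxE i1 a b; have := LaxE i2 c d.
move: (Lax i1 a b) (Lax i2 c d) => A B [M1 M2 M3 M4] [L1 L2 _ _].
rewrite opmx_mulE L1 L2 M2 M4.
exact: (@lax12 C P d1 d2 'X_i1 'X_i2 (mderivM i1) d12 d1x2).
Qed.

Lemma Lax_mul21 a b c d p :
  opmx_mul (Lax i1 a b) (Lax i2 c d) i2 i1 p =
  LX (row11 a c d p) + b *: row21 c d p.
Proof.
rewrite -(Lax_mul11 a b).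
have := LaxE i1 a b; have := LaxE i2 c d.
move: (Lax i1 a b) (Lax i2 c d) => A B [M1 M2 M3 M4] [L1 L2 L3 L4].
rewrite !opmx_mulE L1 L2 L3 L4 M1 M3.
rewrite (lax_row2 d1); congr (_ + _ *: _); exact: (@lax_kernel1 C P d2 'X_i1 'X_i2).
Qed.

Lemma Lax_mul22 a b c d p :
  opmx_mul (Lax i1 a b) (Lax i2 c d) i2 i2 p =
  LX (row12 a d p) + b *: row22 d p.
Proof.
rewrite -(Lax_mul12 a b c).
have := LaxE i1 a b; have := LaxE i2 c d.
move: (Lax i1 a b) (Lax i2 c d) => A B [M1 M2 M3 M4] [L1 L2 L3 L4].
rewrite !opmx_mulE L1 L2 L3 L4 M2 M4.
rewrite (lax_row2 d1); congr (_ + _ *: _); exact: (@lax_kernel2 C P d2 'X_i1 'X_i2).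
Qed.

Local Notation tw := (intertwiner LX LY LDx LDy LE).
Local Notation twrows := (intertwines_rows LX LY LDx LDy LE).

Lemma eulerD_poly a b p : euler (a + b) p = euler a p + b *: p.
Proof. by rewrite /euler scalerDl addrA. Qed.

Definition defining_eq a b c d (T : P -> P) : Prop :=
  op_mull T (opmx_mul (Lax i1 a b) (Lax i2 c d)) =
  op_mulr (opmx_mul (Lax i1 c b) (Lax i2 a d)) T.

Lemma op_eqP (A B : 'M[P -> P]_2) (T : P -> P) :
  op_mull T A = op_mulr B T <-> forall (i j : 'I_2) p, T (A i j p) = B i j (T p).
Proof.
split=> [E i j p|E].
  by have := congr1 (fun M : 'M[P -> P]_2 => M i j p) E; rewrite !mxE.
by apply/matrixP => i j; rewrite !mxE; apply/boolp.funext => p; exact: E.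
Qed.

Lemma ord2_ind (Q : 'I_2 -> Prop) : Q i1 -> Q i2 -> forall i, Q i.
Proof.
move=> Q1 Q2 [[|[|//]] lti]; [move: Q1 | move: Q2]; congr Q; exact: val_inj.
Qed.

Lemma defining_eqP a b c d (T : {linear P -> P}) :
  defining_eq a b c d T <-> twrows a b c d T.
Proof.
split=> [/op_eqP E|[E11 E12 E21 E22]].
  split=> p.
  - exact: etrans (congr1 T (esym (Lax_mul11 a b c d p)))
                  (etrans (E i1 i1 p) (Lax_mul11 c b a d (T p))).
  - exact: etrans (congr1 T (esym (Lax_mul12 a b c d p)))
                  (etrans (E i1 i2 p) (Lax_mul12 c b a d (T p))).
  - exact: etrans (congr1 T (esym (Lax_mul21 a b c d p)))
                  (etrans (E i2 i1 p) (Lax_mul21 c b a d (T p))).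
  - exact: etrans (congr1 T (esym (Lax_mul22 a b c d p)))
                  (etrans (E i2 i2 p) (Lax_mul22 c b a d (T p))).
apply/op_eqP; apply: ord2_ind; apply: ord2_ind => p.
- exact: etrans (congr1 T (Lax_mul11 a b c d p))
                (etrans (E11 p) (esym (Lax_mul11 c b a d (T p)))).
- exact: etrans (congr1 T (Lax_mul12 a b c d p))
                (etrans (E12 p) (esym (Lax_mul12 c b a d (T p)))).
- exact: etrans (congr1 T (Lax_mul21 a b c d p))
                (etrans (E21 p) (esym (Lax_mul21 c b a d (T p)))).
- exact: etrans (congr1 T (Lax_mul22 a b c d p))
                (etrans (E22 p) (esym (Lax_mul22 c b a d (T p)))).
Qed.

(** An alias of [fun_z21d2], to which a structure of linear map is attached. *)
Definition fun_lin (f : nat -> C) : P -> P := fun_z21d2 f.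
HB.instance Definition _ f :=
  GRing.isLinear.Build C P P *:%R (fun_lin f) (fun_z21d2_linear f).

Lemma fun_lin_basis f j k : fun_lin f (basis j k) = f k *: basis j k.
Proof. exact: fun_z21d2_eigen. Qed.

(** In characteristic 0, a monomial of positive degree in z_i is not killed by
    the derivative along z_i. *)
Lemma polynomial_const p : Dx p = 0 -> Dy p = 0 -> p = p@_0%MM *: 1.
Proof.
move=> Dx0 Dy0; have D2 : p^`M(i2) = 0 by [].
have D1 : p^`M(i1) = 0 by move: Dx0; rewrite /Dx D2 addr0.
apply/mpolyP => m; rewrite mcoeffZ mcoeff1.
have [->|/eqP m0] := eqVneq m 0%MM; first by rewrite mulr1.
rewrite mulr0.
suff [i [Di mi]] : exists i, p^`M(i) = 0 /\ (0 < m i)%N.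
  have := mcoeff_deriv i (m - U_(i))%MM p; rewrite Di mcoeff0 submK.
    move/esym/eqP; rewrite -mulr_natr mulf_eq0 pnatr_eq0 orbF.
    by move/eqP.
  apply/mnm_lepP => l; rewrite mnm1E.
  by case: eqP => // <-.
have [m1|] := ltnP 0 (m i1); first by exists i1.
have [m2|] := ltnP 0 (m i2); first by exists i2.
rewrite !leqn0 => /eqP m2 /eqP m1; case: m0.
by apply/mnmP; apply: ord2_ind; rewrite mnm0E.
Qed.

Lemma Y_neq0 : Y != 0.
Proof.
by apply/eqP => Y0; have := Dy_Y; rewrite Y0 linear0 => /esym/eqP; rewrite oner_eq0.
Qed.

Lemma basis00_span p : Dx p = 0 -> euler 0 p = 0 -> exists s, p = s *: basis 0 0.
Proof.
move=> Dx0 N0; exists p@_0%MM; rewrite /basis !expr0 mulr1; apply: polynomial_const => //.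
move: N0; rewrite /euler scale0r addr0 => /eqP; rewrite mulf_eq0 (negPf Y_neq0) /=.
by move/eqP.
Qed.

Lemma fun_lin_intertwiner (f : nat -> C) a c d :
  (forall k, f k.+1 * (k%:R + (c - d)) = f k * (k%:R + (a - d))) ->
  tw a c d (fun_lin f).
Proof.
move=> fS.
exact: (@diag_intertwiner C P LX LY LDx LDy LE basis (@eq_on_basis)
  (@mulX_basis) (@mulY_basis) (@Dx_basis) (@Dy_basis) (@euler_basis)
  a c d f (fun_lin f) (fun_lin_basis f) fS).
Qed.

Lemma intertwiner_fun_lin a c d (T : {linear P -> P}) (f : nat -> C) :
  (forall k, k%:R + (c - d) != 0) -> f 0%N != 0 ->
  (forall k, f k.+1 * (k%:R + (c - d)) = f k * (k%:R + (a - d))) ->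
  tw a c d T -> exists s, forall p, T p = s *: fun_lin f p.
Proof.
move=> cd0 f0 fS Ttw.
have [s Ts] := @intertwiner_diag C P LX LY LDx LDy LE basis
  (@mulX_basis) (@mulY_basis) (@Dx_basis) (@euler_basis)
  basis00_span a c d f T cd0 f0 fS Ttw.
exists s; apply: (eq_on_basis (T := s \*: (fun_lin f))) => j k.
by rewrite Ts -(fun_lin_basis f j k).
Qed.

Lemma defining_eq_intertwiner a b c d (T : {linear P -> P}) :
  (forall l m : bool,
     defining_eq (a + l%:R) (b + m%:R) (c + l%:R) (d + l%:R) T) ->
  tw a c d T.
Proof.
move=> H; apply: (rows_intertwiner eulerD_poly (b := b)) => l m.
exact: (defining_eqP _ _ _ _ _).1 (H l m).
Qed.

Lemma intertwiner_defining_eq a b c d (T : {linear P -> P}) :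
  tw a c d T -> defining_eq a b c d T.
Proof. by move=> Ttw; apply/defining_eqP; exact: intertwiner_rows. Qed.

End Polynomials.

(** * Generic parameters *)

Section GenericTriples.
Variable R : realType.
Local Notation C := R[i].
Implicit Types a b c d : C.

Lemma generic3P a c d : generic [:: a; c; d] <->
  [/\ forall m : int, a - c <> m%:~R, forall m : int, a - d <> m%:~R
    & forall m : int, c - d <> m%:~R].
Proof.
split=> [H|[ac ad cd]].
  by split; [exact: (H 0%N 1%N) | exact: (H 0%N 2%N) | exact: (H 1%N 2%N)].
by move=> [|[|i]] [|[|[|j]]] //=; rewrite ?andbF.
Qed.

Lemma generic4P a b c d : generic [:: a; b; c; d] <->
  generic [:: a; c; d] /\ forall m : int,
    [/\ a - b <> m%:~R, b - c <> m%:~R & b - d <> m%:~R].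
Proof.
split=> [H|[/generic3P[ac ad cd] bH]].
  split; last by move=> m; split; [exact: (H 0%N 1%N) | exact: (H 1%N 2%N) | exact: (H 1%N 3%N)].
  by apply/generic3P; split; [exact: (H 0%N 2%N) | exact: (H 0%N 3%N) | exact: (H 2%N 3%N)].
by move=> [|[|[|i]]] [|[|[|[|j]]]] //=; rewrite ?andbF // => _ m; have [] := bH m.
Qed.

Lemma generic_shift a c d l : generic [:: a; c; d] ->
  generic [:: a + l; c + l; d + l].
Proof.
have sh (u v : C) : u + l - (v + l) = u - v by rewrite opprD addrACA subrr addr0.
by move=> /generic3P[ac ad cd]; apply/generic3P; split; rewrite sh.
Qed.

Lemma Im_int (m : int) : complex.Im (m%:~R : C) = 0.
Proof.
have -> : (m%:~R : C) = (m%:~R : R)%:C%C by rewrite rmorph_int.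
by [].
Qed.

Lemma ImB a b : complex.Im (a - b) = complex.Im a - complex.Im b.
Proof. by case: a b => ? ? [? ?]. Qed.

Lemma Im_shift a (n : nat) : complex.Im (a + n%:R) = complex.Im a.
Proof.
have -> : (n%:R : C) = (n%:R : R)%:C%C by rewrite rmorph_nat.
by case: a => ? ? /=; rewrite addr0.
Qed.

(** A parameter b with a large imaginary part differs from a, c, d by a nonreal
    number, which integer shifts cannot change. *)
Lemma generic_extend a c d : generic [:: a; c; d] ->
  exists b, forall l m : bool,
    generic [:: a + l%:R; b + m%:R; c + l%:R; d + l%:R].
Proof.
move=> acd.
pose t : R := `|complex.Im a| + `|complex.Im c| + `|complex.Im d| + 1.
have Im_neq (u v : C) (l m : bool) : complex.Im u != complex.Im v ->
    forall k : int, u + l%:R - (v + m%:R) <> k%:~R.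
  move=> uv k /(congr1 (@complex.Im R)); rewrite Im_int ImB !Im_shift => /eqP.
  by rewrite subr_eq0 (negPf uv).
have n0 (x : R) := normr_ge0 x.
have ta : complex.Im a < t.
  have := ler_norm (complex.Im a); have := n0 (complex.Im c); have := n0 (complex.Im d).
  by rewrite /t; lra.
have tc : complex.Im c < t.
  have := ler_norm (complex.Im c); have := n0 (complex.Im a); have := n0 (complex.Im d).
  by rewrite /t; lra.
have td : complex.Im d < t.
  have := ler_norm (complex.Im d); have := n0 (complex.Im c); have := n0 (complex.Im a).
  by rewrite /t; lra.
exists (0 +i* t)%C => l m; apply/generic4P; split; first exact: generic_shift.
by move=> k; split; apply: Im_neq => /=; rewrite ?(lt_eqF ta) ?(gt_eqF tc) ?(gt_eqF td).
Qed.

Lemma nonpole_nonint (z : C) : (forall m : int, z <> m%:~R) -> GammaFacts.nonpole z.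
Proof.
move=> zm n; apply/eqP => zn; apply: (zm (- n%:Z)); apply/eqP.
by rewrite rmorphN /= -subr_eq0 opprK; apply/eqP.
Qed.

(** Gamma (a - d + k) / Gamma (c - d + k) normalised to be 1 at k = 0.  It is
    visibly a function of a - d and c - d, whence the shift invariance. *)
Definition pochhammer_ratio a c d (k : nat) : C :=
  \prod_(0 <= i < k) ((i%:R + (a - d)) / (i%:R + (c - d))).

Definition gamma_ratio a c d (k : nat) : C :=
  ComplexGamma.Gamma (k%:R + a - d) / ComplexGamma.Gamma (k%:R + c - d).

(** The recursion that both sequences satisfy is the one that makes a diagonal
    operator an intertwiner, see [fun_lin_intertwiner]. *)
Lemma pochhammer_ratioS a c d : generic [:: a; c; d] -> forall k,
  pochhammer_ratio a c d k.+1 * (k%:R + (c - d)) =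
  pochhammer_ratio a c d k * (k%:R + (a - d)).
Proof.
move=> /generic3P[_ _ /nonpole_nonint cd] k; rewrite /pochhammer_ratio big_nat_recr//=.
by rewrite -!mulrA mulVf ?mulr1// addrC cd.
Qed.

Lemma nonpoleD (z : C) (k : nat) : GammaFacts.nonpole z -> GammaFacts.nonpole (k%:R + z).
Proof. by move=> zP n; rewrite addrAC -natrD addrC zP. Qed.

Lemma gamma_ratioS a c d : generic [:: a; c; d] -> forall k,
  gamma_ratio a c d k.+1 * (k%:R + (c - d)) = gamma_ratio a c d k * (k%:R + (a - d)).
Proof.
move=> /generic3P[_ /nonpole_nonint ad /nonpole_nonint cd] k.
have GS (u : C) : GammaFacts.nonpole (u - d) ->
    ComplexGamma.Gamma (k.+1%:R + u - d) =
    (k%:R + (u - d)) * ComplexGamma.Gamma (k%:R + u - d).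
  move=> ud; rewrite -!addrA -(GammaFacts.GammaS (nonpoleD k ud)).
  by rewrite -natr1 addrAC.
rewrite /gamma_ratio !GS//.
have G0 : ComplexGamma.Gamma (k%:R + c - d) != 0.
  by rewrite -addrA GammaFacts.Gamma_neq0//; exact: nonpoleD.
have k0 : k%:R + (c - d) != 0 by rewrite addrC cd.
move: (k%:R + (c - d)) (ComplexGamma.Gamma _) (ComplexGamma.Gamma _) k0 G0.
by move=> x g h x0 g0; field; rewrite x0 g0.
Qed.

Lemma gamma_ratio0_neq0 a c d : generic [:: a; c; d] -> gamma_ratio a c d 0 != 0.
Proof.
move=> /generic3P[_ /nonpole_nonint ad /nonpole_nonint cd].
by rewrite /gamma_ratio !add0r mulf_neq0 ?invr_eq0 ?GammaFacts.Gamma_neq0.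
Qed.

End GenericTriples.

Theorem proposition1 (R : realType) :
  (exists R1 : op_family R,
    [/\ shift_invariant R1,
        defining_equations R1
      & forall u1 v1 v2 : R[i], generic [:: u1; v1; v2] ->
          nonzero_op (R1 u1 v1 v2)])
  /\
  (forall R1 : op_family R,
    shift_invariant R1 -> defining_equations R1 ->
    forall u1 v1 v2 : R[i], generic [:: u1; v1; v2] ->
      nonzero_op (R1 u1 v1 v2) ->
      exists2 c : R[i], c != 0 &
        forall p : {mpoly R[i][2]},
          R1 u1 v1 v2 p = c *: gamma_quotient u1 v1 v2 p).
Proof.
split.
  pose R1 : op_family R := fun a c d => fun_lin (pochhammer_ratio a c d).
  exists R1; split.
  - move=> a c d l _ p; congr (fun_z21d2 _ p); apply/boolp.funext => k.
    have sh (u : R[i]) : u + l - (d + l) = u - d.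
      by rewrite opprD addrACA subrr addr0.
    by rewrite /pochhammer_ratio !sh.
  - move=> a b c d /generic4P[acd _]; apply: intertwiner_defining_eq.
    exact: fun_lin_intertwiner (pochhammer_ratioS acd).
  - move=> a c d acd; exists (basis R 0 0).
    have -> : R1 a c d (basis R 0 0) = pochhammer_ratio a c d 0 *: basis R 0 0.
      exact: fun_lin_basis.
    rewrite /pochhammer_ratio big_geq// scale1r /basis !expr0 mulr1.
    exact: oner_neq0.
move=> R1 R1shift R1eq a c d acd [p0 Rp0].
(* the auxiliary values b + m of u2 and the shifts by l feed the comparison
   made in [rows_intertwiner] *)
have [b bP] := generic_extend acd.
have Req (l m : bool) :
    defining_eq (a + l%:R) (b + m%:R) (c + l%:R) (d + l%:R) (R1 a c d).
  have := R1eq _ _ _ _ (bP l m); rewrite /defining_eq.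
  have -> // : (R1 (a + l%:R) (c + l%:R) (d + l%:R) : _ -> _) = R1 a c d.
  by apply/boolp.funext => p; rewrite -R1shift.
have Rtw := defining_eq_intertwiner Req.
have cd0 (k : nat) : k%:R + (c - d) != 0.
  by have /generic3P[_ _ /nonpole_nonint cd] := acd; rewrite addrC cd.
have [s Rs] := intertwiner_fun_lin cd0 (gamma_ratio0_neq0 acd) (gamma_ratioS acd) Rtw.
exists s => //.
by apply: contraNneq Rp0 => s0; rewrite Rs s0 scale0r.
Qed.
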